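(* There are positive universal constants $c_1,c_2$ such that the following holds. For $d\ge2$ let $f_d(\mathbf{x})=\frac{1}{2\pi d^3}\sin\!\big(2\pi d^3\|\mathbf{x}\|^2\big)$ on $B_d$ (a $1$-Lipschitz function). Let $w(d,1/\epsilon)$ be a width function such that for every $d\ge 2$ and every $\epsilon>0$ there is a depth-$2$ ReLU network $N$ of width $w(d,1/\epsilon)$, all of whose weights are bounded in absolute value by $\frac{2^{d+1}}{2\pi d^3}$, satisfying $\sup_{\mathbf{x}\in B_d}|N(\mathbf{x})-f_d(\mathbf{x})|\le\epsilon$. Then for every $d>c_1$, $$w\big(d,\,101\,e^{2}\pi^3 d^3\big)\ge 2^{c_2 d\log d}.$$ In particular, depth-$2$ networks of width $\mathrm{poly}(d,1/\epsilon)$ (with such weight bounds) cannot approximate $f_d$ to accuracy $\epsilon$.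
   Context: $\|\cdot\|$ is the Euclidean norm, $B_d=\{\mathbf{x}\in\mathbb{R}^d:\|\mathbf{x}\|\le1\}$. A depth-$2$ ReLU network of width $w$ is $\mathbf{x}\mapsto\sum_{i=1}^{w}v_i\max\{0,\mathbf{w}_i^\top\mathbf{x}+b_i\}+b_0$.
   Formalization: The parenthetical claim that f_d is 1-Lipschitz is false (its gradient has norm 2 at unit vectors, so it is only 2-Lipschitz) and is dropped; weights include biases; the closing ''in particular'' about poly(d,1/ε) width is not stated separately, being immediate from the bound. *)

(* Defs.v *)
From Stdlib Require Import Reals.
Open Scope R_scope.

(* Vectors of R^d are functions nat -> R, only coordinates 0..d-1 matter. *)
Definition dot (d : nat) (u x : nat -> R) : R :=
  sum_f_R0 (fun i => u i * x i) (pred d) * (if Nat.eqb d 0 then 0 else 1).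

Definition sqnorm (d : nat) (x : nat -> R) : R := dot d x x.

Definition norm (d : nat) (x : nat -> R) : R := sqrt (sqnorm d x).

Definition in_ball (d : nat) (x : nat -> R) : Prop := norm d x <= 1.

Definition relu (t : R) : R := Rmax 0 t.

Definition net2 (d w : nat) (W : nat -> nat -> R) (b v : nat -> R) (b0 : R)
  (x : nat -> R) : R :=
  (match w with
   | O => 0
   | S k => sum_f_R0 (fun i => v i * relu (dot d (W i) x + b i)) k
   end) + b0.

Definition params_bounded (d w : nat) (W : nat -> nat -> R) (b v : nat -> R)
  (b0 : R) (B : R) : Prop :=
  (forall i j, (i < w)%nat -> (j < d)%nat -> Rabs (W i j) <= B) /\
  (forall i, (i < w)%nat -> Rabs (b i) <= B) /\
  (forall i, (i < w)%nat -> Rabs (v i) <= B) /\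
  Rabs b0 <= B.

Definition f_target (d : nat) (x : nat -> R) : R :=
  / (2 * PI * INR d ^ 3) * sin (2 * PI * INR d ^ 3 * sqnorm d x).

Definition wbound (d : nat) : R := 2 ^ (S d) / (2 * PI * INR d ^ 3).

Definition valid_width (wf : nat -> R -> nat) : Prop :=
  forall (d : nat) (eps : R), (2 <= d)%nat -> 0 < eps ->
    exists (W : nat -> nat -> R) (b v : nat -> R) (b0 : R),
      params_bounded d (wf d (/ eps)) W b v b0 (wbound d) /\
      forall x, in_ball d x ->
        Rabs (net2 d (wf d (/ eps)) W b v b0 x - f_target d x) <= eps.

(* Main.v *)
Require Import Defs.
From Stdlib Require Import Reals Lra Lia List ZArith.
Import ListNotations.
Open Scope R_scope.

(** For grid points a, b in [0, q)^d, scaled by the factor 1/s with s^2 = 2 d^3 q, the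
    argument of the sine at (a + b)/s is a function of a, plus a function of b, plus
    2 pi <a, b> / q.  So the target matrix H(a, b) = sin(...) is, up to diagonal unitary
    factors, the imaginary part of a discrete Fourier transform of size M = q^d, whose
    operator norm sqrt M makes its correlation with any product phi(a) psi(b) of bounded
    functions at most M^(3/2).  A neuron relu(s(a) + t(b)) is an average of such products,
    because relu(v - u) is the length of the interval [u, v]; hence a network of width w
    with weights of size 2^O(d) has correlation at most w 2^O(d) M^(3/2) with H.  The
    target itself has correlation of order M^2 / d^3, so w >= 2^(-O(d)) sqrt M, and
    q = 2d + 1 gives sqrt M = d^Omega(d).  Taking q odd makes the kernel of the doubled
    angle again a Fourier transform, which shows that sin^2 averages to about 1/2. *)

(** * Finite sums over lists *)

Fixpoint lsum {A : Type} (l : list A) (f : A -> R) : R :=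
  match l with
  | [] => 0
  | x :: l' => f x + lsum l' f
  end.

Section ListSums.
Context {A : Type}.
Implicit Types (l : list A) (f g : A -> R).

Lemma lsum_ext l f g : (forall x, In x l -> f x = g x) -> lsum l f = lsum l g.
Proof.
  induction l as [|x l IH]; simpl; intros H; [easy|].
  now rewrite (H x), IH by auto.
Qed.

Lemma lsum_le l f g : (forall x, In x l -> f x <= g x) -> lsum l f <= lsum l g.
Proof.
  induction l as [|x l IH]; simpl; intros H; [lra|].
  apply Rplus_le_compat; auto.
Qed.

Lemma lsum_plus l f g : lsum l (fun x => f x + g x) = lsum l f + lsum l g.
Proof. induction l as [|x l IH]; simpl; [|rewrite IH]; ring. Qed.

Lemma lsum_minus l f g : lsum l (fun x => f x - g x) = lsum l f - lsum l g.
Proof. induction l as [|x l IH]; simpl; [|rewrite IH]; ring. Qed.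

Lemma lsum_scal_l l c f : lsum l (fun x => c * f x) = c * lsum l f.
Proof. induction l as [|x l IH]; simpl; [|rewrite IH]; ring. Qed.

Lemma lsum_scal_r l c f : lsum l (fun x => f x * c) = lsum l f * c.
Proof. induction l as [|x l IH]; simpl; [|rewrite IH]; ring. Qed.

Lemma lsum_const l c : lsum l (fun _ => c) = INR (length l) * c.
Proof.
  induction l as [|x l IH]; [simpl; ring|].
  cbn [lsum length]; rewrite IH, S_INR; ring.
Qed.

Lemma lsum_app l l' f : lsum (l ++ l') f = lsum l f + lsum l' f.
Proof. induction l as [|x l IH]; simpl; [|rewrite IH]; ring. Qed.

Lemma lsum_Rabs l f : Rabs (lsum l f) <= lsum l (fun x => Rabs (f x)).
Proof.
  induction l as [|x l IH]; simpl; [rewrite Rabs_R0; lra|].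
  eapply Rle_trans; [apply Rabs_triang|lra].
Qed.

Lemma lsum_Rabs_le l f c :
  (forall x, In x l -> Rabs (f x) <= c) -> Rabs (lsum l f) <= INR (length l) * c.
Proof.
  intros H; eapply Rle_trans; [apply lsum_Rabs|].
  rewrite <- lsum_const; now apply lsum_le.
Qed.

(** Cauchy-Schwarz against the constant function 1, by induction on the list. *)
Lemma lsum_sqr_le l f : Rsqr (lsum l f) <= INR (length l) * lsum l (fun x => Rsqr (f x)).
Proof.
  induction l as [|x l IH]; [simpl; unfold Rsqr; lra|].
  cbn [lsum length]; rewrite S_INR.
  set (n := INR (length l)) in *; set (s := lsum l f) in *.
  set (t := lsum l (fun x => Rsqr (f x))) in *.
  assert (Hn : 0 <= n) by apply pos_INR.
  (* This is $(n f(x) - s)^2 \ge 0$ divided by $n$, with $s^2 \le n t$ from the induction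
     hypothesis; $n = 0$ forces the empty list. *)
  assert (Hcross : 2 * f x * s <= n * Rsqr (f x) + t).
  { destruct (Req_dec n 0) as [E|E].
    - assert (l = []) by (destruct l; [easy|];
        unfold n in E; cbn [length] in E; rewrite S_INR in E;
        pose proof (pos_INR (length l)); lra).
      subst l; unfold s, t; simpl; rewrite E; unfold Rsqr; lra.
    - apply Rmult_le_reg_l with n; [lra|].
      pose proof (Rle_0_sqr (n * f x - s)); unfold Rsqr in *; nra. }
  unfold Rsqr in *; nra.
Qed.

End ListSums.

Lemma lsum_exchange {A B : Type} (l : list A) (l' : list B) (F : A -> B -> R) :
  lsum l (fun x => lsum l' (F x)) = lsum l' (fun y => lsum l (fun x => F x y)).
Proof.
  induction l as [|x l IH]; simpl.
  - rewrite lsum_const; ring.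
  - now rewrite IH, lsum_plus.
Qed.

Lemma lsum_map {A B : Type} (h : B -> A) (l : list B) f : lsum (map h l) f = lsum l (fun y => f (h y)).
Proof. induction l as [|y l IH]; simpl; congruence. Qed.

Lemma lsum_flat_map {A B : Type} (h : B -> list A) (l : list B) f :
  lsum (flat_map h l) f = lsum l (fun y => lsum (h y) f).
Proof.
  induction l as [|y l IH]; simpl; [easy|].
  now rewrite lsum_app, IH.
Qed.

Lemma lsum_mul {A B : Type} (l : list A) (l' : list B) f g :
  lsum l f * lsum l' g = lsum l (fun x => lsum l' (fun y => f x * g y)).
Proof.
  rewrite <- lsum_scal_r; apply lsum_ext; intros x _.
  now rewrite lsum_scal_l.
Qed.

Lemma lsum_seq_S (n : nat) (f : nat -> R) :
  lsum (seq 0 (S n)) f = lsum (seq 0 n) f + f n.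
Proof. rewrite seq_S, lsum_app; simpl; ring. Qed.

Lemma sum_f_R0_lsum (f : nat -> R) (n : nat) : sum_f_R0 f n = lsum (seq 0 (S n)) f.
Proof.
  induction n as [|n IH]; [simpl; ring|].
  rewrite lsum_seq_S, <- IH; reflexivity.
Qed.

Lemma dot_lsum (d : nat) (u x : nat -> R) :
  dot d u x = lsum (seq 0 d) (fun i => u i * x i).
Proof.
  unfold dot; destruct d as [|d]; [simpl; ring|].
  cbn [pred Nat.eqb]; rewrite sum_f_R0_lsum; ring.
Qed.

Lemma net2_lsum (d w : nat) W b v b0 x :
  net2 d w W b v b0 x =
  lsum (seq 0 w) (fun i => v i * relu (dot d (W i) x + b i)) + b0.
Proof.
  unfold net2; destruct w as [|w]; [easy|].
  now rewrite sum_f_R0_lsum.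
Qed.

(** * Exponential sums over the grid *)

Definition upd (v : nat -> nat) (i m : nat) : nat -> nat :=
  fun j => if Nat.eqb j i then m else v j.

(** Coordinates from [d] on are 0, so for positive [q] every value of a grid point is below [q], at
    any index. *)
Fixpoint grid (q d : nat) : list (nat -> nat) :=
  match d with
  | O => [fun _ => O]
  | S d' => flat_map (fun v => map (upd v d') (seq 0 q)) (grid q d')
  end.

Definition ip (d : nat) (a b : nat -> nat) : R :=
  lsum (seq 0 d) (fun j => INR (a j) * INR (b j)).

Lemma lsum_grid_S (q d : nat) F :
  lsum (grid q (S d)) F = lsum (grid q d) (fun v => lsum (seq 0 q) (fun m => F (upd v d m))).
Proof.
  cbn [grid]; rewrite lsum_flat_map; apply lsum_ext; intros v _; apply lsum_map.
Qed.

Lemma length_grid (q d : nat) : length (grid q d) = (q ^ d)%nat.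
Proof.
  induction d as [|d IH]; [easy|].
  cbn [grid]; rewrite (flat_map_constant_length (c := q)).
  - rewrite IH; simpl; lia.
  - intros v _; now rewrite length_map, length_seq.
Qed.

Lemma grid_bound (q d : nat) v j : (0 < q)%nat -> In v (grid q d) -> (v j < q)%nat.
Proof.
  intros Hq; revert v; induction d as [|d IH]; intros v.
  - intros [<-|[]]; exact Hq.
  - cbn [grid]; rewrite in_flat_map; intros (u & Hu & Hv).
    apply in_map_iff in Hv; destruct Hv as (m & <- & Hm).
    apply in_seq in Hm; unfold upd; destruct (Nat.eqb j d); [lia|auto].
Qed.

Lemma ip_upd_l (d m : nat) v b :
  ip (S d) (upd v d m) b = ip d v b + INR m * INR (b d).
Proof.
  unfold ip; rewrite lsum_seq_S; unfold upd at 2; rewrite Nat.eqb_refl; f_equal.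
  apply lsum_ext; intros j Hj; apply in_seq in Hj; unfold upd.
  replace (Nat.eqb j d) with false; [easy|].
  symmetry; apply Nat.eqb_neq; lia.
Qed.

(** The factor $2\sin(x/2)$ turns each cosine into a difference of sines at $c + mx \pm x/2$, and
    these telescope. *)
Lemma dirichlet_telescope (n : nat) (c x : R) :
  2 * sin (x / 2) * lsum (seq 0 n) (fun m => cos (c + INR m * x))
  = sin (c + INR n * x - x / 2) - sin (c - x / 2).
Proof.
  induction n as [|n IH].
  - simpl; replace (c + 0 * x - x / 2) with (c - x / 2) by ring; ring.
  - rewrite lsum_seq_S, Rmult_plus_distr_l, IH, S_INR.
    replace (c + (INR n + 1) * x - x / 2) with ((c + INR n * x) + x / 2) by field.
    rewrite (sin_plus (c + INR n * x)), (sin_minus (c + INR n * x)); ring.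
Qed.

(** A nontrivial additive character modulo [q] sums to zero: the two ends of the telescoped sum
    differ by a multiple of $2\pi$. *)
Lemma sum_cos_complete (q k m n : nat) (c : R) :
  Z.gcd (Z.of_nat q) (Z.of_nat k) = 1%Z -> (m < q)%nat -> (n < q)%nat -> m <> n ->
  lsum (seq 0 q) (fun j => cos (c + INR j * (2 * PI * INR k / INR q * (INR m - INR n)))) = 0.
Proof.
  intros Hgcd Hm Hn Hne.
  assert (Hq : 0 < INR q) by (apply lt_0_INR; lia).
  pose proof PI_RGT_0 as HPI.
  set (x := 2 * PI * INR k / INR q * (INR m - INR n)).
  assert (Hsin : sin (x / 2) <> 0).
  { intros E; apply sin_eq_0_0 in E; destruct E as [z Hz].
    assert (E : INR k * (INR m - INR n) = IZR z * INR q).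
    { apply Rmult_eq_reg_r with PI; [|lra].
      replace (IZR z * INR q * PI) with (INR q * (IZR z * PI)) by ring.
      rewrite <- Hz; unfold x; field; lra. }
    rewrite !INR_IZR_INZ, <- minus_IZR, <- !mult_IZR in E; apply eq_IZR in E.
    (* If $\sin(x/2)$ vanished, [q] would divide $k(m-n)$, hence $m-n$ by coprimality, against $0 <
       |m-n| < q$. *)
    assert (Hdiv : (Z.of_nat q | Z.of_nat m - Z.of_nat n)%Z).
    { apply Z.gauss with (Z.of_nat k); [|exact Hgcd]; now exists z. }
    destruct Hdiv as [y Hy].
    assert (y = 0 \/ 1 <= y \/ y <= -1)%Z as [->|[?|?]] by lia; nia. }
  apply Rmult_eq_reg_l with (2 * sin (x / 2)); [|lra].
  rewrite Rmult_0_r, dirichlet_telescope.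
  (* The shift $2\pi k(m-n)$ is split in two because [sin_period] accepts only natural multiples of
     the period. *)
  replace (c + INR q * x - x / 2)
    with (c - x / 2 - 2 * INR (k * n) * PI + 2 * INR (k * m) * PI)
    by (rewrite !mult_INR; unfold x; field; lra).
  rewrite sin_period, <- (sin_period _ (k * n)).
  replace (c - x / 2 - 2 * INR (k * n) * PI + 2 * INR (k * n) * PI) with (c - x / 2) by ring.
  ring.
Qed.

Definition kron (q m n : nat) : R := if Nat.eqb m n then INR q else 0.

Fixpoint kron_prod (q d : nat) (b b' : nat -> nat) : R :=
  match d with
  | O => 1
  | S d' => kron_prod q d' b b' * kron q (b d') (b' d')
  end.

Lemma kron_prod_ext (q d : nat) b b' b'' :
  (forall j, (j < d)%nat -> b' j = b'' j) -> kron_prod q d b b' = kron_prod q d b b''.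
Proof.
  induction d as [|d IH]; intros H; [easy|].
  simpl; rewrite IH, (H d); auto.
Qed.

Lemma sum_kron (q m : nat) : (m < q)%nat -> lsum (seq 0 q) (kron q m) = INR q.
Proof.
  intros H.
  assert (G : forall n, lsum (seq 0 n) (kron q m) = if Nat.ltb m n then INR q else 0).
  { induction n as [|n IH]; [easy|].
    rewrite lsum_seq_S, IH; unfold kron.
    destruct (Nat.ltb_spec m n), (Nat.eqb_spec m n), (Nat.ltb_spec m (S n)); try lia; ring. }
  rewrite G; now destruct (Nat.ltb_spec m q); [|lia].
Qed.

Lemma sum_kron_prod (q d : nat) b :
  (forall j, (b j < q)%nat) -> lsum (grid q d) (kron_prod q d b) = INR q ^ d.
Proof.
  intros Hb; induction d as [|d IH]; [simpl; ring|].
  rewrite lsum_grid_S.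
  rewrite (lsum_ext _ _ (fun v => kron_prod q d b v * INR q)).
  - rewrite lsum_scal_r, IH; simpl; ring.
  - intros v _; rewrite <- (sum_kron q (b d)) by auto.
    rewrite <- lsum_scal_l; apply lsum_ext; intros m _; simpl.
    rewrite (kron_prod_ext q d b (upd v d m) v).
    + unfold upd; now rewrite Nat.eqb_refl.
    + intros j Hj; unfold upd; now destruct (Nat.eqb_spec j d); [lia|].
Qed.

(** Orthogonality of characters, one coordinate at a time: an equal coordinate gives a factor [q], a
    different one makes the inner sum vanish. Later, $k = 1$ is the kernel of the target and $k = 2$
    that of the doubled angle. *)
Lemma grid_orthogonality (q k d : nat) (c : R) b b' :
  Z.gcd (Z.of_nat q) (Z.of_nat k) = 1%Z ->
  (forall j, (b j < q)%nat) -> (forall j, (b' j < q)%nat) ->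
  Rabs (lsum (grid q d) (fun a => cos (c + 2 * PI * INR k / INR q * (ip d a b - ip d a b'))))
  <= kron_prod q d b b'.
Proof.
  intros Hgcd Hb Hb'; set (t := 2 * PI * INR k / INR q).
  induction d as [|d IH].
  - cbn [grid lsum kron_prod]; rewrite Rplus_0_r; apply Rabs_le, COS_bound.
  - rewrite lsum_grid_S; cbn [kron_prod].
    rewrite (lsum_ext _ _ (fun v => lsum (seq 0 q) (fun m =>
      cos ((c + t * (ip d v b - ip d v b')) + INR m * (t * (INR (b d) - INR (b' d))))))).
    2:{ intros v _; apply lsum_ext; intros m _; rewrite !ip_upd_l; f_equal; ring. }
    unfold kron; destruct (Nat.eqb_spec (b d) (b' d)) as [E|E].
    + rewrite (lsum_ext _ _ (fun v => cos (c + t * (ip d v b - ip d v b')) * INR q)).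
      * rewrite lsum_scal_r, Rabs_mult, (Rabs_pos_eq (INR q)) by apply pos_INR.
        apply Rmult_le_compat_r; [apply pos_INR|exact IH].
      * intros v _; rewrite E.
        rewrite (lsum_ext _ _ (fun _ => cos (c + t * (ip d v b - ip d v b')))).
        -- rewrite lsum_const, length_seq; ring.
        -- intros m _; f_equal; ring.
    + rewrite (lsum_ext _ _ (fun _ => 0)).
      * rewrite lsum_const, Rmult_0_r, Rabs_R0, Rmult_0_r; lra.
      * intros v _; now apply sum_cos_complete.
Qed.

(** Real form of Parseval for $\sum_b \psi(b) e^{i(\gamma(b) + t\langle a,b\rangle)}$. Expanding the
    squared modulus and summing over [a] first leaves only the diagonal $b = b'$, where each of the
    $q^d$ points contributes at most $q^d$. *)
Lemma parseval_grid (q k d : nat) (psi gam : (nat -> nat) -> R) :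
  (0 < q)%nat -> Z.gcd (Z.of_nat q) (Z.of_nat k) = 1%Z ->
  (forall b, Rabs (psi b) <= 1) ->
  let t := 2 * PI * INR k / INR q in
  lsum (grid q d) (fun a =>
    Rsqr (lsum (grid q d) (fun b => psi b * cos (gam b + t * ip d a b))) +
    Rsqr (lsum (grid q d) (fun b => psi b * sin (gam b + t * ip d a b))))
  <= INR q ^ d * INR q ^ d.
Proof.
  intros Hq Hgcd Hpsi t; set (X := grid q d).
  rewrite (lsum_ext _ _ (fun a => lsum X (fun b => lsum X (fun b' =>
    psi b * psi b' * cos ((gam b - gam b') + t * (ip d a b - ip d a b')))))).
  2:{ intros a _; unfold Rsqr; rewrite !lsum_mul, <- lsum_plus.
      apply lsum_ext; intros b _; rewrite <- lsum_plus.
      apply lsum_ext; intros b' _.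
      replace (gam b - gam b' + t * (ip d a b - ip d a b'))
        with ((gam b + t * ip d a b) - (gam b' + t * ip d a b')) by ring.
      rewrite cos_minus; ring. }
  rewrite lsum_exchange.
  replace (INR q ^ d * INR q ^ d) with (lsum X (fun _ => INR q ^ d))
    by (unfold X; rewrite lsum_const, length_grid, pow_INR; ring).
  apply lsum_le; intros b Hb; rewrite lsum_exchange.
  rewrite <- (sum_kron_prod q d b) by (intros; eapply grid_bound; eauto).
  apply lsum_le; intros b' Hb'; rewrite lsum_scal_l.
  eapply Rle_trans; [apply Rle_abs|]; rewrite !Rabs_mult.
  assert (G := grid_orthogonality q k d (gam b - gam b') b b' Hgcd
    (fun j => grid_bound q d b j Hq Hb) (fun j => grid_bound q d b' j Hq Hb')).
  fold t X in G; rewrite <- (Rmult_1_l (kron_prod q d b b')).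
  apply Rmult_le_compat; auto using Rabs_pos.
  - apply Rmult_le_pos; apply Rabs_pos.
  - rewrite <- (Rmult_1_l 1); apply Rmult_le_compat; auto using Rabs_pos.
Qed.

(** Cauchy-Schwarz over [a], then Parseval: the square of the sum is at most $M \cdot M^2$. *)
Lemma bilinear_bound (q k d : nat) (phi psi al gam : (nat -> nat) -> R) :
  (0 < q)%nat -> Z.gcd (Z.of_nat q) (Z.of_nat k) = 1%Z ->
  (forall a, Rabs (phi a) <= 1) -> (forall b, Rabs (psi b) <= 1) ->
  Rabs (lsum (grid q d) (fun a => lsum (grid q d) (fun b =>
    phi a * psi b * sin (al a + gam b + 2 * PI * INR k / INR q * ip d a b))))
  <= INR q ^ d * sqrt (INR q ^ d).
Proof.
  intros Hq Hgcd Hphi Hpsi; set (t := 2 * PI * INR k / INR q).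
  set (X := grid q d); set (M := INR q ^ d).
  assert (HM : 0 <= M) by apply pow_le, pos_INR.
  set (C := fun a => lsum X (fun b => psi b * cos (gam b + t * ip d a b))).
  set (S := fun a => lsum X (fun b => psi b * sin (gam b + t * ip d a b))).
  rewrite (lsum_ext _ _ (fun a => phi a * (sin (al a) * C a + cos (al a) * S a))).
  2:{ intros a _; unfold C, S; rewrite Rmult_plus_distr_l, <- !lsum_scal_l, <- lsum_plus.
      apply lsum_ext; intros b _; rewrite Rplus_assoc, sin_plus; ring. }
  apply Rsqr_incr_0_var; [|apply Rmult_le_pos; [exact HM|apply sqrt_pos]].
  rewrite <- Rsqr_abs, Rsqr_mult, Rsqr_sqrt by exact HM.
  eapply Rle_trans; [apply lsum_sqr_le|].
  unfold X at 1; rewrite length_grid, pow_INR; fold M; unfold Rsqr at 2.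
  rewrite Rmult_assoc; apply Rmult_le_compat_l; [exact HM|].
  eapply Rle_trans; [|apply (parseval_grid q k d psi gam Hq Hgcd Hpsi)].
  fold t X; apply lsum_le; intros a _; fold (C a) (S a).
  assert (H1 : Rsqr (phi a) <= 1).
  { rewrite Rsqr_abs, <- Rsqr_1; apply Rsqr_incr_1; auto using Rabs_pos; lra. }
  rewrite Rsqr_mult, <- (Rmult_1_l (Rsqr (C a) + Rsqr (S a))).
  apply Rmult_le_compat; auto using Rle_0_sqr.
  (* The phase [al a] rotates the vector $(C, S)$; the inner sum is one coordinate of the rotated
     vector, and the other coordinate is the square discarded here. *)
  pose proof (sin2_cos2 (al a)) as E; unfold Rsqr in *.
  pose proof (Rle_0_sqr (cos (al a) * C a - sin (al a) * S a)) as H; unfold Rsqr in H.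
  replace (C a * C a + S a * S a)
    with ((sin (al a) * sin (al a) + cos (al a) * cos (al a)) * (C a * C a + S a * S a))
    by (rewrite E; ring).
  nra.
Qed.

Lemma Rabs_le_inv (x y : R) : Rabs x <= y -> - y <= x <= y.
Proof. unfold Rabs; destruct (Rcase_abs x); lra. Qed.

(** * Neurons as averages of rectangles *)

Definition ind_lt (x y : R) : R := if Rlt_dec x y then 1 else 0.

(** For positive [de], counting the multiples of [de] below [v] rounds [v] up to a multiple of
    [de]. *)
Lemma step_count_bounds (n : nat) (de v : R) :
  0 <= de -> 0 <= v <= INR n * de ->
  v <= de * lsum (seq 0 n) (fun k => ind_lt (INR k * de) v) <= v + de.
Proof.
  intros Hde Hv.
  set (s := fun n => de * lsum (seq 0 n) (fun k => ind_lt (INR k * de) v)).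
  (* Invariant: either the count has already covered [v], or every point so far was counted. *)
  assert (G : forall n, (v <= s n \/ INR n * de <= s n) /\ s n <= INR n * de /\ s n <= v + de).
  { intros m; induction m as [|m IH].
    - unfold s; simpl; lra.
    - assert (E : s (S m) = s m + de * ind_lt (INR m * de) v)
        by (unfold s; rewrite lsum_seq_S; ring).
      rewrite E, S_INR; unfold ind_lt; destruct (Rlt_dec (INR m * de) v); lra. }
  specialize (G n); unfold s in G; lra.
Qed.

(* The length of the interval [u, v] is counted by the points k*de it contains,
   and each point contributes a product of a function of u and a function of v. *)
Lemma relu_rectangles (n : nat) (de u v : R) :
  0 <= de -> 0 <= u <= INR n * de -> 0 <= v <= INR n * de ->
  Rabs (relu (v - u) -
        de * lsum (seq 0 n) (fun k => (1 - ind_lt (INR k * de) u) * ind_lt (INR k * de) v))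
  <= de.
Proof.
  intros Hde Hu Hv.
  pose proof (step_count_bounds n de u Hde Hu) as Bu.
  pose proof (step_count_bounds n de v Hde Hv) as Bv.
  unfold relu; destruct (Rle_dec u v) as [H|H].
  - rewrite Rmax_right by lra.
    rewrite (lsum_ext _ _ (fun k => ind_lt (INR k * de) v - ind_lt (INR k * de) u)).
    + rewrite lsum_minus; apply Rabs_le; lra.
    + intros k _; unfold ind_lt.
      destruct (Rlt_dec (INR k * de) u), (Rlt_dec (INR k * de) v); lra.
  - rewrite Rmax_left by lra.
    rewrite (lsum_ext _ _ (fun _ => 0)).
    + rewrite lsum_const; apply Rabs_le; lra.
    + intros k _; unfold ind_lt.
      destruct (Rlt_dec (INR k * de) u), (Rlt_dec (INR k * de) v); lra.
Qed.

Lemma relu_bilinear_bound (q k d : nat) (u v al gam : (nat -> nat) -> R) (L : R) :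
  (0 < q)%nat -> Z.gcd (Z.of_nat q) (Z.of_nat k) = 1%Z ->
  (forall a, In a (grid q d) -> 0 <= u a <= L) ->
  (forall b, In b (grid q d) -> 0 <= v b <= L) ->
  0 <= L ->
  Rabs (lsum (grid q d) (fun a => lsum (grid q d) (fun b =>
    relu (v b - u a) * sin (al a + gam b + 2 * PI * INR k / INR q * ip d a b))))
  <= 2 * L * (INR q ^ d * sqrt (INR q ^ d)).
Proof.
  intros Hq Hgcd Hu Hv HL; set (X := grid q d) in *; set (M := INR q ^ d).
  assert (HM : 1 <= M) by (apply pow_R1_Rle; apply (le_INR 1); lia).
  assert (HMn : INR (q ^ d) = M) by apply pow_INR.
  assert (HX : INR (length X) = M) by (unfold X; now rewrite length_grid).
  (* With $M$ steps the rectangles contribute at most $M \cdot (L/M) \cdot M^{3/2}$, and the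
     rounding error over $M^2$ pairs is at most $LM$, which is no larger; hence the factor 2. *)
  set (de := L / M).
  assert (Hde : 0 <= de) by (apply Rmult_le_pos; [lra|left; apply Rinv_0_lt_compat; lra]).
  assert (HNde : INR (q ^ d) * de = L) by (rewrite HMn; unfold de; field; lra).
  set (th := fun a b => al a + gam b + 2 * PI * INR k / INR q * ip d a b).
  set (rect := fun a b => lsum (seq 0 (q ^ d)) (fun j =>
    (1 - ind_lt (INR j * de) (u a)) * ind_lt (INR j * de) (v b))).
  assert (Hind : forall x y, Rabs (ind_lt x y) <= 1 /\ Rabs (1 - ind_lt x y) <= 1).
  { intros x y; unfold ind_lt; destruct (Rlt_dec x y); split; apply Rabs_le; lra. }
  assert (Hmain : Rabs (lsum X (fun a => lsum X (fun b => de * rect a b * sin (th a b))))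
                  <= L * (M * sqrt M)).
  { rewrite (lsum_ext _ _ (fun a => lsum (seq 0 (q ^ d)) (fun j => de * lsum X (fun b =>
      (1 - ind_lt (INR j * de) (u a)) * ind_lt (INR j * de) (v b) * sin (th a b))))).
    2:{ intros a _; rewrite lsum_scal_l, lsum_exchange, <- lsum_scal_l.
        apply lsum_ext; intros b _; unfold rect.
        rewrite lsum_scal_r; ring. }
    rewrite lsum_exchange.
    replace (L * (M * sqrt M)) with (INR (length (seq 0 (q ^ d))) * (de * (M * sqrt M)))
      by (rewrite length_seq, <- Rmult_assoc, HNde; ring).
    apply lsum_Rabs_le; intros j _.
    rewrite lsum_scal_l, Rabs_mult, (Rabs_pos_eq de) by exact Hde.
    apply Rmult_le_compat_l; [exact Hde|].
    apply bilinear_bound with (phi := fun a => 1 - ind_lt (INR j * de) (u a))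
      (psi := fun b => ind_lt (INR j * de) (v b)); auto; intros; apply Hind. }
  assert (Herr : Rabs (lsum X (fun a => lsum X (fun b =>
                   (relu (v b - u a) - de * rect a b) * sin (th a b)))) <= L * M).
  { replace (L * M) with (INR (length X) * (INR (length X) * de))
      by (rewrite HX; unfold de; field; lra).
    apply lsum_Rabs_le; intros a Ha; apply lsum_Rabs_le; intros b Hb.
    rewrite Rabs_mult, <- (Rmult_1_r de); apply Rmult_le_compat; auto using Rabs_pos.
    - rewrite Rmult_1_r; apply relu_rectangles; rewrite ?HNde; auto.
    - apply Rabs_le, SIN_bound. }
  rewrite (lsum_ext _ _ (fun a =>
    lsum X (fun b => (relu (v b - u a) - de * rect a b) * sin (th a b)) +
    lsum X (fun b => de * rect a b * sin (th a b)))).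
  2:{ intros a _; rewrite <- lsum_plus; apply lsum_ext; intros b _; unfold th; ring. }
  rewrite lsum_plus; eapply Rle_trans; [apply Rabs_triang|].
  assert (Hs : 1 <= sqrt M) by (rewrite <- sqrt_1; apply sqrt_le_1_alt, HM).
  assert (L * M <= L * (M * sqrt M)) by (apply Rmult_le_compat_l; nra).
  lra.
Qed.

(** * The grid inside the ball *)

Section Grid.
Variable d : nat.
Hypothesis Hd : (5 <= d)%nat.

Let q := (2 * d + 1)%nat.
Let D := INR d.
Let Q := INR q.
Let M := Q ^ d.

(* Chosen so that 2 pi d^3 |x + y|^2 contains the cross term 2 pi <a, b> / q. *)
Definition scale : R := sqrt (2 * D ^ 3 * Q).

Definition point (a b : nat -> nat) : nat -> R := fun j => (INR (a j) + INR (b j)) / scale.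

Definition phase (a : nat -> nat) : R := PI / Q * ip d a a.

(** The factor [INR 1] keeps the shape of [bilinear_bound] at $k = 1$. *)
Definition angle (a b : nat -> nat) : R := phase a + phase b + 2 * PI * INR 1 / Q * ip d a b.

Lemma D_ge5 : 5 <= D.
Proof. unfold D; replace 5 with (INR 5) by (simpl; ring); now apply le_INR. Qed.

Lemma Q_eq : Q = 2 * D + 1.
Proof. unfold Q, q, D; rewrite plus_INR, mult_INR; simpl; ring. Qed.

Lemma scale_sqr : scale * scale = 2 * D ^ 3 * Q.
Proof.
  unfold scale; apply sqrt_sqrt; pose proof D_ge5; pose proof Q_eq.
  assert (0 < D ^ 3) by (apply pow_lt; lra); nra.
Qed.

Lemma scale_ge : 2 * Q <= scale.
Proof.
  pose proof D_ge5; pose proof Q_eq as E.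
  unfold scale; rewrite <- (sqrt_square (2 * Q)) by lra; apply sqrt_le_1_alt.
  assert (2 * Q <= D ^ 3) by (rewrite E; simpl; nra).
  nra.
Qed.

(** Expand $\|a+b\|^2$ and use $2\pi d^3 / s^2 = \pi/q$. *)
Lemma sqnorm_point a b :
  2 * PI * D ^ 3 * sqnorm d (point a b) = angle a b.
Proof.
  pose proof scale_sqr as Hs; pose proof scale_ge; pose proof D_ge5; pose proof Q_eq.
  unfold sqnorm; rewrite dot_lsum; unfold angle, phase, ip, point.
  rewrite (lsum_ext _ _ (fun j => / (2 * D ^ 3 * Q) *
    (INR (a j) * INR (a j) + INR (b j) * INR (b j) + 2 * (INR (a j) * INR (b j))))).
  2:{ intros j _; rewrite <- Hs; field; lra. }
  rewrite lsum_scal_l, !lsum_plus, lsum_scal_l; simpl INR.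
  field; split; lra.
Qed.

Lemma point_coord_bound a b j :
  In a (grid q d) -> In b (grid q d) ->
  0 <= INR (a j) / scale <= 1 /\ 0 <= INR (b j) / scale <= 1 /\
  0 <= point a b j <= 2 * Q / scale.
Proof.
  intros Ha Hb; pose proof scale_ge; pose proof D_ge5; pose proof Q_eq.
  assert (Hq : (0 < q)%nat) by (unfold q; lia).
  assert (Ba : INR (a j) <= Q) by (apply le_INR, Nat.lt_le_incl; eapply grid_bound; eauto).
  assert (Bb : INR (b j) <= Q) by (apply le_INR, Nat.lt_le_incl; eapply grid_bound; eauto).
  pose proof (pos_INR (a j)); pose proof (pos_INR (b j)).
  assert (Hi : 0 < / scale) by (apply Rinv_0_lt_compat; lra).
  assert (E : scale * / scale = 1) by (apply Rinv_r; lra).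
  unfold point, Rdiv; repeat split; nra.
Qed.

(** Each coordinate is at most $2q/s$, so the squared norm is at most $4dq^2/s^2 = 2q/d^2$. This is
    at most 1 when $2(2d+1) \le d^2$, which holds from $d = 5$ on. *)
Lemma point_in_ball a b : In a (grid q d) -> In b (grid q d) -> in_ball d (point a b).
Proof.
  intros Ha Hb; pose proof scale_sqr as Hs; pose proof scale_ge.
  pose proof D_ge5; pose proof Q_eq as E.
  unfold in_ball, norm; rewrite <- sqrt_1; apply sqrt_le_1_alt.
  unfold sqnorm; rewrite dot_lsum.
  apply Rle_trans with (lsum (seq 0 d) (fun _ => 2 * Q / D ^ 3)).
  - apply lsum_le; intros j _.
    destruct (point_coord_bound a b j Ha Hb) as (_ & _ & Hp).
    replace (2 * Q / D ^ 3) with ((2 * Q / scale) * (2 * Q / scale)).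
    + apply Rmult_le_compat; lra.
    + replace (2 * Q / scale * (2 * Q / scale)) with (4 * Q * Q / (scale * scale))
        by (field; lra).
      rewrite Hs; field; lra.
  - rewrite lsum_const, length_seq; fold D.
    replace (D * (2 * Q / D ^ 3)) with (2 * Q / (D * D)) by (field; lra).
    apply Rmult_le_reg_r with (D * D); [nra|].
    unfold Rdiv; rewrite Rmult_assoc, Rinv_l by nra; nra.
Qed.

(** * Correlations with the target *)

Lemma gcd_q_1 : Z.gcd (Z.of_nat q) (Z.of_nat 1) = 1%Z.
Proof. apply Z.gcd_1_r. Qed.

Lemma gcd_q_2 : Z.gcd (Z.of_nat q) (Z.of_nat 2) = 1%Z.
Proof. apply Z.bezout_1_gcd; exists 1%Z, (- Z.of_nat d)%Z; unfold q; lia. Qed.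

(** Write $\sin^2\theta = 1/2 - \cos(2\theta)/2$ and $\cos 2\theta = \sin(\pi/2 + 2\theta)$. The
    last term is a kernel with $k = 2$, coprime to the odd [q], so [bilinear_bound] with constant
    functions controls its sum. *)
Lemma sum_sin_sqr_ge :
  (M * M - M * sqrt M) / 2
  <= lsum (grid q d) (fun a => lsum (grid q d) (fun b => sin (angle a b) * sin (angle a b))).
Proof.
  assert (Hq : (0 < q)%nat) by (unfold q; lia).
  assert (HX : INR (length (grid q d)) = M) by (rewrite length_grid; apply pow_INR).
  pose proof D_ge5; pose proof Q_eq.
  assert (G := bilinear_bound q 2 d (fun _ => 1) (fun _ => 1)
    (fun a => 2 * phase a + PI / 2) (fun b => 2 * phase b) Hq gcd_q_2).
  cbv beta in G; fold Q M in G.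
  rewrite (lsum_ext _ (fun a => lsum _ (fun b => sin (angle a b) * sin (angle a b)))
    (fun a => lsum (grid q d) (fun _ => / 2) - / 2 * lsum (grid q d) (fun b => 1 * 1 *
      sin (2 * phase a + PI / 2 + 2 * phase b + 2 * PI * INR 2 / Q * ip d a b)))).
  - rewrite lsum_minus, lsum_scal_l, !lsum_const, HX.
    assert (H1 : Rabs 1 <= 1) by (rewrite Rabs_R1; lra).
    specialize (G (fun _ => H1) (fun _ => H1)).
    set (T := lsum _ _) in *; pose proof (Rle_abs T); lra.
  - intros a _; rewrite <- lsum_scal_l, <- lsum_minus; apply lsum_ext; intros b _.
    replace (2 * phase a + PI / 2 + 2 * phase b + 2 * PI * INR 2 / Q * ip d a b)
      with (PI / 2 + 2 * angle a b) by (unfold angle; simpl INR; field; lra).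
    rewrite <- cos_sin, cos_2a_sin; field.
Qed.

Lemma M_ge1 : 1 <= M.
Proof. pose proof D_ge5; pose proof Q_eq; apply pow_R1_Rle; lra. Qed.

(** The preactivation at $(a+b)/s$ is $h(a) + h(b) + c$. Adding and subtracting $L = (d+1)B$ writes
    it as $v(b) - u(a)$ with both functions in $[0, 2L]$, since $|h| \le dB$ and $|c| \le B$. *)
Lemma neuron_correlation (W : nat -> R) (c B : R) :
  (forall j, (j < d)%nat -> Rabs (W j) <= B) -> Rabs c <= B ->
  Rabs (lsum (grid q d) (fun a => lsum (grid q d) (fun b =>
    relu (dot d W (point a b) + c) * sin (angle a b))))
  <= 4 * ((D + 1) * B) * (M * sqrt M).
Proof.
  intros HW Hc.
  assert (Hq : (0 < q)%nat) by (unfold q; lia).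
  pose proof D_ge5; pose proof scale_ge; pose proof Q_eq.
  assert (HB : 0 <= B) by (pose proof (Rabs_pos c); lra).
  set (h := fun a : nat -> nat => lsum (seq 0 d) (fun j => W j * (INR (a j) / scale))).
  assert (Hh : forall a, In a (grid q d) -> - (D * B) <= h a <= D * B).
  { intros a Ha; apply Rabs_le_inv; unfold D; rewrite <- (length_seq d 0) at 1.
    apply lsum_Rabs_le; intros j Hj; apply in_seq in Hj.
    destruct (point_coord_bound a a j Ha Ha) as (Hp & _).
    rewrite Rabs_mult, (Rabs_pos_eq (_ / _)) by lra.
    rewrite <- (Rmult_1_r B); apply Rmult_le_compat; try lra; [apply Rabs_pos|].
    apply HW; lia. }
  apply Rabs_le_inv in Hc.
  set (L := (D + 1) * B).
  rewrite (lsum_ext _ _ (fun a => lsum (grid q d) (fun b =>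
    relu ((h b + L) - (L - (h a + c))) * sin (angle a b)))).
  - replace (4 * L) with (2 * (2 * L)) by ring.
    apply relu_bilinear_bound with (u := fun a => L - (h a + c)) (v := fun b => h b + L);
      auto using gcd_q_1; try (intros x Hx; specialize (Hh x Hx)); unfold L; nra.
  - intros a _; apply lsum_ext; intros b _; do 2 f_equal.
    rewrite dot_lsum; unfold h, point.
    rewrite (lsum_ext _ (fun i => W i * _) (fun j =>
      W j * (INR (a j) / scale) + W j * (INR (b j) / scale))).
    + rewrite lsum_plus; ring.
    + intros j _; field; lra.
Qed.

Lemma network_correlation (w : nat) W b v b0 B :
  params_bounded d w W b v b0 B ->
  Rabs (lsum (grid q d) (fun a => lsum (grid q d) (fun a' =>
    net2 d w W b v b0 (point a a') * sin (angle a a'))))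
  <= (INR w * (B * (4 * ((D + 1) * B))) + B) * (M * sqrt M).
Proof.
  intros (HW & Hb & Hv & Hb0).
  assert (Hq : (0 < q)%nat) by (unfold q; lia).
  assert (HMs : 0 <= M * sqrt M)
    by (pose proof M_ge1; apply Rmult_le_pos; [lra|apply sqrt_pos]).
  pose proof D_ge5.
  set (X := grid q d).
  rewrite (lsum_ext _ _ (fun a =>
    lsum (seq 0 w) (fun i => v i * lsum X (fun a' =>
      relu (dot d (W i) (point a a') + b i) * sin (angle a a'))) +
    (* The output bias is a constant function, so it falls under [bilinear_bound] with $\phi = \psi
       = 1$; hence the shape [1 * 1]. *)
    b0 * lsum X (fun a' => 1 * 1 * sin (angle a a')))).
  2:{ intros a _; rewrite <- lsum_scal_l.
      rewrite (lsum_ext (seq 0 w) _ (fun i => lsum X (fun a' =>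
        v i * relu (dot d (W i) (point a a') + b i) * sin (angle a a')))).
      - rewrite lsum_exchange, <- lsum_plus; apply lsum_ext; intros a' _.
        rewrite net2_lsum, lsum_scal_r; ring.
      - intros i _; rewrite <- lsum_scal_l; apply lsum_ext; intros; ring. }
  rewrite lsum_plus, lsum_exchange, lsum_scal_l.
  eapply Rle_trans; [apply Rabs_triang|]; rewrite Rmult_plus_distr_r.
  apply Rplus_le_compat.
  - rewrite Rmult_assoc; rewrite <- (length_seq w 0) at 2.
    apply lsum_Rabs_le; intros i Hi; apply in_seq in Hi.
    rewrite lsum_scal_l, Rabs_mult, Rmult_assoc.
    apply Rmult_le_compat; try apply Rabs_pos; [apply Hv; lia|].
    apply neuron_correlation; [intros j Hj; apply HW; lia|apply Hb; lia].
  - rewrite Rabs_mult; apply Rmult_le_compat; try apply Rabs_pos; [exact Hb0|].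
    assert (H1 : Rabs 1 <= 1) by (rewrite Rabs_R1; lra).
    apply (bilinear_bound q 1 d (fun _ => 1) (fun _ => 1)); auto using gcd_q_1.
Qed.

(** The network correlates with the sine at least as much as the target does, up to an error
    $\epsilon M^2$. Comparing with the upper bound and dividing by $M\sqrt M$ gives the claim. *)
Lemma width_inequality (w : nat) W b v b0 B eps :
  params_bounded d w W b v b0 B ->
  (forall x, in_ball d x -> Rabs (net2 d w W b v b0 x - f_target d x) <= eps) ->
  / (2 * PI * D ^ 3) * ((sqrt M - 1) / 2) - eps * sqrt M
  <= INR w * (B * (4 * ((D + 1) * B))) + B.
Proof.
  intros Hp Happ; pose proof (network_correlation w W b v b0 B Hp) as HN.
  pose proof sum_sin_sqr_ge as HS; pose proof M_ge1 as HM; pose proof D_ge5.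
  set (X := grid q d) in *.
  assert (HX : INR (length X) = M) by (unfold X; rewrite length_grid; apply pow_INR).
  set (amp := / (2 * PI * D ^ 3)).
  assert (Hamp : 0 < amp).
  { apply Rinv_0_lt_compat; pose proof PI_RGT_0.
    apply Rmult_lt_0_compat; [lra|apply pow_lt; lra]. }
  set (SS := lsum X (fun a => lsum X (fun b => sin (angle a b) * sin (angle a b)))) in *.
  set (NN := lsum X _) in HN.
  assert (HE : Rabs (NN - amp * SS) <= M * (M * eps)).
  { unfold NN, SS; rewrite <- lsum_scal_l, <- lsum_minus, <- HX.
    apply lsum_Rabs_le; intros a Ha; rewrite <- lsum_scal_l, <- lsum_minus.
    apply lsum_Rabs_le; intros a' Ha'.
    pose proof (Happ _ (point_in_ball a a' Ha Ha')) as G.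
    unfold f_target in G; fold D amp in G; rewrite sqnorm_point in G.
    replace (_ - _) with
      ((net2 d w W b v b0 (point a a') - amp * sin (angle a a')) * sin (angle a a')) by ring.
    rewrite Rabs_mult, <- (Rmult_1_r eps); apply Rmult_le_compat; auto using Rabs_pos.
    apply Rabs_le, SIN_bound. }
  apply Rabs_le_inv in HE, HN.
  assert (Hs : 0 < sqrt M) by (apply sqrt_lt_R0; lra).
  assert (HMs : sqrt M * sqrt M = M) by (apply sqrt_sqrt; lra).
  apply Rmult_le_reg_r with (M * sqrt M); [nra|].
  assert (amp * ((M * M - M * sqrt M) / 2) <= amp * SS)
    by (apply Rmult_le_compat_l; lra).
  replace ((amp * ((sqrt M - 1) / 2) - eps * sqrt M) * (M * sqrt M)) with
    (amp * ((M * (sqrt M * sqrt M) - M * sqrt M) / 2) - eps * M * (sqrt M * sqrt M))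
    by field.
  rewrite HMs; lra.
Qed.

End Grid.

(** * Numerical estimates and the final comparison *)

Lemma pow_exp_ln (x : R) (n : nat) : 0 < x -> x ^ n = exp (INR n * ln x).
Proof. intros Hx; now rewrite <- Rpower_pow by exact Hx. Qed.

Lemma sqrt_exp (x : R) : sqrt (exp x) = exp (x / 2).
Proof.
  rewrite <- (sqrt_square (exp (x / 2))) by apply Rlt_le, exp_pos.
  rewrite <- exp_plus; do 2 f_equal; field.
Qed.

Lemma wbound_le (d : nat) : (5 <= d)%nat ->
  0 <= wbound d /\ wbound d <= 2 ^ d /\ (INR d + 1) * wbound d <= 2 ^ d.
Proof.
  intros Hd; pose proof (D_ge5 d Hd) as HD; pose proof PI2_3_2.
  assert (HP : 0 < 2 ^ d) by (apply pow_lt; lra).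
  assert (H3 : INR d + 1 <= INR d ^ 3) by (simpl; nra).
  assert (Hi : 0 < / (PI * INR d ^ 3)) by (apply Rinv_0_lt_compat; nra).
  assert (E : wbound d = 2 ^ d * / (PI * INR d ^ 3))
    by (unfold wbound; simpl; field; split; lra).
  assert (Hone : PI * INR d ^ 3 * / (PI * INR d ^ 3) = 1) by (apply Rinv_r; nra).
  assert (K : (INR d + 1) * / (PI * INR d ^ 3) <= 1).
  { rewrite <- Hone; apply Rmult_le_compat_r; nra. }
  rewrite E; repeat split; nra.
Qed.

(** The prescribed accuracy is at most an eighth of the amplitude of the target; $\pi > 3$ and $e^2
    \ge 3$ suffice. *)
Lemma eps_le_amp (x : R) : 0 < x ->
  / (101 * exp 2 * PI ^ 3 * x) <= / (2 * PI * x) / 8.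
Proof.
  intros Hx; pose proof PI2_3_2; pose proof (exp_ineq1_le 2).
  assert (E : PI ^ 3 = PI * (PI * PI)) by ring.
  assert (9 <= PI * PI) by nra.
  assert (HP : 9 * PI <= PI ^ 3) by (rewrite E; nra).
  replace (/ (2 * PI * x) / 8) with (/ (16 * PI * x)) by (field; lra).
  apply Rinv_le_contravar; [nra|].
  apply Rmult_le_compat_r; nra.
Qed.

Lemma exponential_gap (d : nat) (y : R) : exp 30 < INR d ->
  exp (INR d * ln (INR d) / 2) <= 64 * INR d ^ 3 * 4 ^ d * (4 * y + 1) ->
  Rpower 2 (/ 4 * INR d * ln (INR d)) <= y.
Proof.
  intros Hd H; set (D := INR d) in *; set (l := ln D) in *.
  pose proof (exp_ineq1_le 30); assert (HD : 31 <= D) by lra.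
  assert (Hl : 30 < l) by (rewrite <- (ln_exp 30); apply ln_increasing; [apply exp_pos|lra]).
  assert (E2 : 2 < exp 1) by (pose proof (exp_ineq1 1); lra).
  assert (L2 : ln 2 <= 1).
  { left; rewrite <- (ln_exp 1); apply ln_increasing; lra. }
  assert (Hl2 : 0 < ln 2) by (rewrite <- ln_1; apply ln_increasing; lra).
  assert (E4 : 4 ^ d = exp (D * (2 * ln 2))).
  { rewrite pow_exp_ln by lra; replace 4 with (2 * 2) by lra; rewrite ln_mult by lra.
    fold D; f_equal; ring. }
  assert (E3 : D ^ 3 = exp (3 * l)).
  { rewrite pow_exp_ln by lra; fold l; f_equal; simpl; ring. }
  set (z := Rpower 2 (/ 4 * D * l)).
  assert (Hz1 : 1 <= z).
  { unfold z, Rpower; rewrite <- exp_0; left; apply exp_increasing.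
    repeat apply Rmult_lt_0_compat; lra. }
  (* $320 = 64 \cdot 5$, and $2^9 = 512$ already exceeds it. *)
  assert (E320 : 320 <= exp 9).
  { replace 9 with (1 + 1 + 1 + 1 + 1 + 1 + 1 + 1 + 1) by ring; rewrite !exp_plus.
    replace (exp 1) with (2 + (exp 1 - 2)) by ring.
    apply Rle_trans with (2 * 2 * 2 * 2 * 2 * 2 * 2 * 2 * 2); [lra|].
    repeat (apply Rmult_le_compat; try lra). }
  assert (Hbig : exp 9 * exp (3 * l) * exp (D * (2 * ln 2)) * z <= exp (D * l / 2)).
  { unfold z, Rpower; rewrite <- !exp_plus.
    (* With $\ln 2 \le 1$ it is enough that $9 + 3l + 2D \le Dl/4$, which $l > 30$ and $D \ge 31$
       ensure. *)
    assert (K : 9 + 3 * l + D * (2 * ln 2) + / 4 * D * l * ln 2 <= D * l / 2).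
    { assert (D * ln 2 <= D) by nra.
      assert (D * l * ln 2 <= D * l) by (rewrite <- (Rmult_1_r (D * l)) at 2;
        apply Rmult_le_compat_l; nra).
      nra. }
    destruct K as [K|K]; [left; now apply exp_increasing|right; now rewrite K]. }
  rewrite <- E3, <- E4 in Hbig.
  set (P := D ^ 3 * 4 ^ d).
  assert (HP : 0 < P) by (apply Rmult_lt_0_compat; apply pow_lt; lra).
  assert (K : 320 * P * z <= exp (D * l / 2)).
  { eapply Rle_trans; [|exact Hbig].
    replace (exp 9 * D ^ 3 * 4 ^ d * z) with (exp 9 * P * z) by (unfold P; ring).
    repeat (apply Rmult_le_compat_r; [lra|]); exact E320. }
  (* Cancelling gives $5z \le 4y + 1$, and $z \ge 1$ absorbs the 1. *)
  assert (Hfin : 64 * P * (5 * z) <= 64 * P * (4 * y + 1)) by (unfold P in *; lra).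
  apply Rmult_le_reg_l in Hfin; lra.
Qed.

Theorem theorem4 :
  exists c1 c2 : R, 0 < c1 /\ 0 < c2 /\
    forall wf : nat -> R -> nat, valid_width wf ->
      forall d : nat, c1 < INR d ->
        Rpower 2 (c2 * INR d * ln (INR d))
          <= INR (wf d (101 * exp 2 * PI ^ 3 * INR d ^ 3)).
Proof.
  (* The threshold $e^{30}$ makes $\ln d > 30$, so the losses $d^3$ and $4^d$ use up less than half
     of the exponent $\frac12 d\ln d$ of $\sqrt M$. *)
  exists (exp 30), (/ 4); split; [apply exp_pos|split; [lra|]].
  intros wf Hwf d Hd.
  assert (H5 : (5 <= d)%nat).
  { apply INR_le; pose proof (exp_ineq1_le 30); simpl; lra. }
  pose proof (D_ge5 d H5) as HD; pose proof PI2_3_2; pose proof PI_4.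
  pose proof (exp_pos 2).
  set (D := INR d) in *; set (r := 101 * exp 2 * PI ^ 3 * D ^ 3).
  assert (HD3 : 0 < D ^ 3) by (apply pow_lt; lra).
  assert (Hr : 0 < r).
  { assert (0 < PI ^ 3) by (apply pow_lt; lra).
    apply Rmult_lt_0_compat; [apply Rmult_lt_0_compat|]; lra. }
  destruct (Hwf d (/ r)) as (W & b & v & b0 & Hp & Happ);
    [lia|now apply Rinv_0_lt_compat|].
  rewrite Rinv_inv in Hp, Happ; set (w := wf d r) in *.
  pose proof (width_inequality d H5 w W b v b0 _ _ Hp Happ) as HW; fold D in HW.
  destruct (wbound_le d H5) as (B0 & B1 & B2); fold D in B2.
  set (B := wbound d) in *.
  pose proof (eps_le_amp (D ^ 3) HD3) as Heps; fold r in Heps.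
  set (M := INR (2 * d + 1) ^ d) in *; set (amp := / (2 * PI * D ^ 3)) in *.
  apply exponential_gap; [exact Hd|]; fold D.
  assert (HM : exp (D * ln D) <= M).
  { unfold M, D; rewrite <- pow_exp_ln by (fold D; lra).
    apply pow_incr; fold D; split; [lra|]; apply le_INR; lia. }
  assert (Hs : exp (D * ln D / 2) <= sqrt M) by (rewrite <- sqrt_exp; now apply sqrt_le_1_alt).
  eapply Rle_trans; [exact Hs|].
  assert (Hs2 : 2 <= sqrt M).
  { eapply Rle_trans; [|exact Hs].
    assert (0 < ln D) by (rewrite <- ln_1; apply ln_increasing; lra).
    assert (1 < ln D).
    { rewrite <- (ln_exp 1); apply ln_increasing; [apply exp_pos|].
      pose proof exp_le_3; lra. }
    pose proof (exp_ineq1_le (D * ln D / 2)); nra. }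
  (* This uses $\pi \le 4$. *)
  assert (Hamp : / (8 * D ^ 3) <= amp) by (apply Rinv_le_contravar; nra).
  (* As $\sqrt M \ge 2$, the main term is at least [amp] $\cdot \sqrt M/4$; the accuracy costs at
     most half of that. *)
  assert (Hlow : / (8 * D ^ 3) * sqrt M / 8 <= amp * ((sqrt M - 1) / 2) - / r * sqrt M).
  { assert (0 < / (8 * D ^ 3)) by (apply Rinv_0_lt_compat; lra).
    assert (/ r * sqrt M <= amp / 8 * sqrt M) by (apply Rmult_le_compat_r; lra).
    assert (amp * (sqrt M / 4) <= amp * ((sqrt M - 1) / 2))
      by (apply Rmult_le_compat_l; lra).
    assert (/ (8 * D ^ 3) * sqrt M <= amp * sqrt M) by (apply Rmult_le_compat_r; lra).
    lra. }
  assert (E4 : 4 ^ d = 2 ^ d * 2 ^ d) by (rewrite <- Rpow_mult_distr; f_equal; ring).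
  assert (H2d : 1 <= 2 ^ d) by (apply pow_R1_Rle; lra).
  assert (Hhigh : INR w * (B * (4 * ((D + 1) * B))) + B <= 4 ^ d * (4 * INR w + 1)).
  { pose proof (pos_INR w).
    assert (B * ((D + 1) * B) <= 4 ^ d) by (rewrite E4; apply Rmult_le_compat; nra).
    assert (INR w * (B * ((D + 1) * B)) <= INR w * 4 ^ d) by (apply Rmult_le_compat_l; lra).
    nra. }
  apply Rmult_le_reg_l with (/ (8 * D ^ 3) / 8).
  - assert (0 < / (8 * D ^ 3)) by (apply Rinv_0_lt_compat; lra); lra.
  - replace (/ (8 * D ^ 3) / 8 * (64 * D ^ 3 * 4 ^ d * (4 * INR w + 1)))
      with (4 ^ d * (4 * INR w + 1)) by (field; lra).
    lra.
Qed.
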